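(* Let $K$ be an algebraically closed field, let $R=K[x_1,\dots,x_N]$ be a polynomial ring over $K$, let $m\le n$ be positive integers, and let $X$ be an $(m\times n)$-matrix with entries in $R$. Let $t$ be an integer such that $1\le t\le m$ and $t<n$. If some entry of $X$ is zero, then \[ \operatorname{ara} I_t(X)\le mn-t^2 . \]
   Context: $I_t(X)$ denotes the ideal of $R$ generated by all $t$-minors of $X$, i.e. the determinants of all $(t\times t)$-submatrices of $X$. For an ideal $I$ of a Noetherian ring $S$, the arithmetical rank $\operatorname{ara} I$ is the minimum number $r$ of elements $f_1,\dots,f_r\in S$ such that $\sqrt{I}=\sqrt{(f_1,\dots,f_r)}$. *)

(* Defs.v *)
From mathcomp Require Import all_boot all_order all_algebra.
From mathcomp Require Import mpoly.

Set Implicit Arguments.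
Unset Strict Implicit.
Unset Printing Implicit Defensive.

Local Open Scope ring_scope.

(* Ideals are Prop-valued predicates: the boolean [idealr] structures of
   [ring_quotient] would require decidable membership. *)

Definition ideal_gen (R : comNzRingType) (S : R -> Prop) : R -> Prop :=
  fun a => exists (k : nat) (c s : 'I_k -> R),
    (forall i, S (s i)) /\ a = \sum_(i < k) c i * s i.

Definition ideal_radical (R : comNzRingType) (I : R -> Prop) : R -> Prop :=
  fun a => exists k : nat, I (a ^+ k).

Definition ideal_gen_by (R : comNzRingType) (r : nat) (f : 'I_r -> R) :
    R -> Prop :=
  ideal_gen (fun a => exists i, a = f i).

Definition generated_up_to_radical (R : comNzRingType) (I : R -> Prop)
    (r : nat) : Prop :=
  exists f : 'I_r -> R,
    forall a, ideal_radical I a <-> ideal_radical (ideal_gen_by f) a.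

(* The minimum is a relation rather than a function, so that no junk value is
   needed for ideals that are not finitely generated up to radical. *)
Definition is_ara (R : comNzRingType) (I : R -> Prop) (r : nat) : Prop :=
  generated_up_to_radical I r /\
  forall s : nat, generated_up_to_radical I s -> (r <= s)%N.

(* A t x t submatrix is given by strictly increasing choices of t rows and
   t columns. *)
Definition is_minor (R : comNzRingType) (m n t : nat) (X : 'M[R]_(m, n))
    (a : R) : Prop :=
  exists (f : 'I_t -> 'I_m) (g : 'I_t -> 'I_n),
    [/\ {homo f : i j / (i < j)%N}, {homo g : i j / (i < j)%N}
      & a = \det (mxsub f g X)].

Definition minors_ideal (R : comNzRingType) (m n t : nat) (X : 'M[R]_(m, n)) :
    R -> Prop :=
  ideal_gen (is_minor t X).

(* Main.v *)
(** Radical membership can be tested at points with values in fields (primes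
    avoiding an element), so it suffices to find [m * n - t ^ 2] polynomials
    that vanish at every point where [X] has rank < [t] and at no other point.

    Call the [m] x [m] minors of the ([n] + [m]) x [m] matrix with blocks [X^T]
    and [1] that use at least [t] of the first [n] rows admissible, and let the
    weight of such a minor be the sum of its row indices.  There are
    [m * n - t ^ 2 + 1] possible weights.  At a point of rank >= [t] exactly one
    admissible minor of least weight is nonzero, by the exchange property, so
    the sums of all admissible minors of a given weight define [I_t] up to
    radical.

    To save one equation, move the zero entry to the corner and shear [X] by
    column operations that replace the corner entry 0 by [z], the admissible
    minor of greatest weight, without changing [z] or any rank.  If the sums of
    all weights except the greatest vanish for the sheared matrix at a point of
    rank >= [t], then [z] is nonzero there, whereas by exchange the first column
    of the sheared matrix is zero, hence so is its corner entry [z]. *)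

From HB Require Import structures.
Require Import Defs.
From mathcomp Require Import all_boot all_order all_algebra perm mpoly zify.
From mathcomp Require boolp classical_sets.

Set Implicit Arguments.
Unset Strict Implicit.
Unset Printing Implicit Defensive.
Import GRing.Theory.
Local Open Scope ring_scope.
Local Open Scope quotient_scope.

(** * Points of a radical ideal *)

Section IdealPredicates.
Variable R : comNzRingType.

Definition is_ideal (I : R -> Prop) : Prop :=
  [/\ I 0, forall x y, I x -> I y -> I (x + y) & forall a x, I x -> I (a * x)].

Definition is_prime_ideal (P : R -> Prop) : Prop :=
  [/\ is_ideal P, ~ P 1 & forall x y, P (x * y) -> P x \/ P y].

Lemma ideal_gen_mem (S : R -> Prop) x : S x -> ideal_gen S x.
Proof.
move=> Sx; exists 1%N, (fun=> 1), (fun=> x); split=> //.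
by rewrite big_ord1 mul1r.
Qed.

Lemma is_ideal_gen (S : R -> Prop) : is_ideal (ideal_gen S).
Proof.
split.
- exists 0%N, (fun=> 0), (fun=> 0); split; last by rewrite big_ord0.
  by case.
- move=> _ _ [k [c [s [Ss ->]]]] [l [d [r [Sr ->]]]].
  exists (k + l)%N,
    (fun i => match split i with inl j => c j | inr j => d j end),
    (fun i => match split i with inl j => s j | inr j => r j end).
  split; first by move=> i; case: (split i).
  rewrite big_split_ord /=; congr (_ + _); apply: eq_bigr => i _.
    by rewrite (unsplitK (inl i)).
  by rewrite (unsplitK (inr i)).
- move=> a _ [k [c [s [Ss ->]]]].
  exists k, (fun i => a * c i), s; split=> //.
  by rewrite big_distrr; apply: eq_bigr => i _; rewrite /= mulrA.
Qed.

Lemma is_ideal_addM (I : R -> Prop) x :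
  is_ideal I -> is_ideal (fun z => exists y c, I y /\ z = y + c * x).
Proof.
move=> [I0 ID IM]; split.
- by exists 0, 0; split; rewrite // mul0r addr0.
- move=> _ _ [y [c [Iy ->]]] [z [d [Iz ->]]]; exists (y + z), (c + d).
  by split; [apply: ID | rewrite mulrDl addrACA].
- move=> a _ [y [c [Iy ->]]]; exists (a * y), (a * c).
  by split; [apply: IM | rewrite mulrDr mulrA].
Qed.

(** Zorn's lemma on the ideals that contain [I] and no power of [a]: the union of a nonempty chain
    is again one, and [I] bounds the empty chain. *)
Lemma maximal_ideal_avoiding_powers (I : R -> Prop) (a : R) :
  is_ideal I -> ~ ideal_radical I a ->
  exists P : R -> Prop,
    [/\ is_ideal P, (forall x, I x -> P x), (forall k, ~ P (a ^+ k)) &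
     forall J : R -> Prop, is_ideal J -> (forall x, P x -> J x) ->
       (forall k, ~ J (a ^+ k)) -> forall x, J x -> P x].
Proof.
move=> idI aI.
pose good J := [/\ is_ideal J, (forall x, I x -> J x) & forall k, ~ J (a ^+ k)].
pose T := {J : R -> Prop | good J}.
have gI : good I by split=> // k Ik; apply: aI; exists k.
pose le (J L : T) : bool := boolp.asbool (forall x, sval J x -> sval L x).
have leP J L : le J L <-> (forall x, sval J x -> sval L x).
  by rewrite /le; split=> [/boolp.asboolP|H] //; apply/boolp.asboolP.
have [|J L M /leP JL /leP LM|J L /leP JL /leP LJ|A totA|[P gP] maxP] :=
    @classical_sets.Zorn T le.
- by move=> J; apply/leP.
- by apply/leP => x /JL/LM.
- case: J JL LJ => J gJ; case: L => L gL /= JL LJ.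
  have E : J = L by apply: boolp.funext => x; apply: boolp.propext; split; auto.
  by subst L; congr exist; apply: boolp.Prop_irrelevance.
- have [[J0 AJ0]|nA] := boolp.pselect (exists J, A J); last first.
    by exists (exist _ I gI) => J AJ; case: nA; exists J.
  pose U x := exists2 J, A J & sval J x.
  have gU : good U.
    split=> [|x Ix|k [J AJ]]; last by case: (svalP J) => _ _ /(_ k).
    - split.
      + by exists J0 => //; case: (svalP J0) => -[].
      + move=> x y [J AJ Jx] [L AL Ly].
        have [/leP JL|/leP LJ] := totA J L AJ AL.
          by exists L => //; case: (svalP L) => -[_ LD _] _ _; apply: LD; auto.
        by exists J => //; case: (svalP J) => -[_ JD _] _ _; apply: JD; auto.
      + move=> b x [J AJ Jx]; exists J => //.
        by case: (svalP J) => -[_ _ JM] _ _; apply: JM.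
    - by exists J0 => //; case: (svalP J0) => _ /(_ x Ix).
  by exists (exist _ U gU) => J AJ; apply/leP => x Jx; exists J.
- exists P; case: (gP) => idP IP aP; split=> // J idJ PJ aJ x Jx.
  have gJ : good J by split=> // y /IP/PJ.
  have /(congr1 sval) /= <- // : exist _ J gJ = exist _ P gP.
  by apply: maxP; apply/leP.
Qed.

(** A maximal [P] is prime: if [x] and [y] lie outside [P], then [P + (x)] and [P + (y)] each
    contain a power of [a]. The product of these powers lies in [P + (x y)], which is [P] as soon as
    [x y] is in [P]. *)
Lemma prime_ideal_avoiding (I : R -> Prop) (a : R) :
  is_ideal I -> ~ ideal_radical I a ->
  exists P : R -> Prop,
    [/\ is_prime_ideal P, forall x, I x -> P x & ~ P a].
Proof.
move=> idI /(maximal_ideal_avoiding_powers idI)[P [idP IP aP maxP]].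
exists P; split=> //; last exact: (aP 1%N).
split=> //; first exact: (aP 0%N).
move=> x y Pxy; case: (idP) => P0 PD PM.
suff meet z : ~ P z -> exists k y c, P y /\ a ^+ k = y + c * z.
  have [|Px] := boolp.pselect (P x); first by left.
  have [|Py] := boolp.pselect (P y); first by right.
  have [k [u [c [Pu Ek]]]] := meet _ Px.
  have [l [v [d [Pv El]]]] := meet _ Py.
  case: (aP (k + l)%N); rewrite exprD Ek El mulrDr.
  apply: (PD); first exact: (PM).
  rewrite mulrDl (mulrC u); apply: (PD); first exact: (PM).
  by rewrite mulrACA; apply: (PM).
move=> Pz; apply: boolp.contrapT => H; apply: Pz.
apply: (maxP _ (is_ideal_addM z idP)).
- by move=> w Pw; exists w, 0; rewrite mul0r addr0.
- by move=> k [w [c [Pw E]]]; apply: H; exists k, w, c.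
- by exists 0, 1; rewrite mul1r add0r.
Qed.

End IdealPredicates.

Section ResidueField.
Variables (R : comNzRingType) (P : R -> Prop).
Hypothesis primeP : is_prime_ideal P.

Definition idealb : {pred R} := fun x => boolp.asbool (P x).

Lemma idealbP x : reflect (P x) (x \in idealb).
Proof. exact: boolp.asboolP. Qed.

Fact idealb_closed : idealr_closed idealb.
Proof.
case: primeP => -[P0 PD PM] P1 _; split.
- exact/idealbP.
- exact/idealbP.
- move=> a x y /idealbP Px /idealbP Py; apply/idealbP.
  by apply: PD => //; apply: PM.
Qed.

HB.instance Definition _ := isIdealr.Build R idealb idealb_closed.

Fact idealb_prime : prime_idealr_closed idealb.
Proof.
case: primeP => _ _ PM x y /idealbP/PM[] H.
  by apply/orP; left; apply/idealbP.
by apply/orP; right; apply/idealbP.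
Qed.

HB.instance Definition _ := isPrimeIdealrClosed.Build R idealb idealb_prime.

Definition residue_domain := {ideal_quot idealb}.
HB.instance Definition _ := GRing.ComNzRing.on residue_domain.

(** [{fraction _}] expects a domain with a unit predicate, so units and inverses are chosen
    classically. *)
Definition rd_unit : pred residue_domain :=
  fun x => boolp.asbool (exists y, y * x = 1).
Definition rd_inv (x : residue_domain) : residue_domain :=
  match boolp.pselect (exists y, y * x = 1) with
  | left e => sval (boolp.cid e) | right _ => x end.

Fact rd_mulVx : {in rd_unit, left_inverse 1 rd_inv *%R}.
Proof.
move=> x /boolp.asboolP ux; rewrite /rd_inv.
by case: boolp.pselect => // e; case: boolp.cid.
Qed.
Fact rd_unitPl x y : y * x = 1 -> rd_unit x.
Proof. by move=> yx; apply/boolp.asboolP; exists y. Qed.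
Fact rd_invr_out : {in [predC rd_unit], rd_inv =1 id}.
Proof.
move=> x /negP ux; rewrite /rd_inv; case: boolp.pselect => // e.
by case: ux; apply/boolp.asboolP.
Qed.

HB.instance Definition _ := GRing.ComNzRing_hasMulInverse.Build residue_domain
  rd_mulVx rd_unitPl rd_invr_out.
HB.instance Definition _ := GRing.ComUnitRing_isIntegral.Build residue_domain
  (@Quotient.rquot_IdomainAxiom R idealb).

Definition residue (x : R) : residue_domain := \pi_({ideal_quot idealb}) x.

Fact residue_zmod : zmod_morphism residue.
Proof. exact: (rmorphB (\pi_({ideal_quot idealb}))). Qed.
Fact residue_monoid : monoid_morphism residue.
Proof.
by split; [exact: (rmorph1 (\pi_({ideal_quot idealb})))
  | exact: (rmorphM (\pi_({ideal_quot idealb})))].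
Qed.
HB.instance Definition _ :=
  GRing.isZmodMorphism.Build R residue_domain residue residue_zmod.
HB.instance Definition _ :=
  GRing.isMonoidMorphism.Build R residue_domain residue residue_monoid.

Lemma residue_eq0 x : residue x = 0 <-> P x.
Proof.
rewrite -(rmorph0 residue) /residue; split=> [/eqP|Px].
  by rewrite -Quotient.idealrBE subr0 => /idealbP.
by apply/eqP; rewrite -Quotient.idealrBE subr0; apply/idealbP.
Qed.

End ResidueField.

(** The field is the fraction field of [R / P], for a prime [P] that contains [S] and avoids [a]. *)
Lemma radical_field_point (R : comNzRingType) (S : R -> Prop) (a : R) :
  ~ ideal_radical (ideal_gen S) a ->
  exists (F : fieldType) (phi : {rmorphism R -> F}),
    (forall x, S x -> phi x = 0) /\ phi a != 0.
Proof.
move=> /(prime_ideal_avoiding (is_ideal_gen S))[P [primeP SP aP]].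
pose phi : {rmorphism R -> {fraction (residue_domain primeP)}} :=
  (@tofrac _ \o residue primeP)%FUN.
exists {fraction (residue_domain primeP)}, phi.
have phi0 x : phi x = 0 <-> P x.
  rewrite -(residue_eq0 primeP) /phi /=.
  by split=> [/eqP|->]; [rewrite tofrac_eq0 => /eqP | rewrite rmorph0].
by split=> [x Sx|]; [apply/phi0/SP/ideal_gen_mem | apply/eqP => /phi0].
Qed.

(** * Bases among the rows of a matrix *)

Section RowSpan.
Variables (F : fieldType) (p m : nat) (V : 'M[F]_(p, m)).
Implicit Types (b c d h : {set 'I_p}) (e g i : 'I_p).

Definition rspan c : 'M[F]_m := (\sum_(i in c) <<row i V>>)%MS.
Definition indep c := \rank (rspan c) == #|c|.
Definition row_basis c := (#|c| == m) && row_full (rspan c).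

Lemma row_rspan c i : i \in c -> (row i V <= rspan c)%MS.
Proof. by move=> ci; apply: (sumsmx_sup i) => //; rewrite genmxE. Qed.

Lemma rspan_subP q (A : 'M_(q, m)) c :
  reflect (forall i, i \in c -> (row i V <= A)%MS) (rspan c <= A)%MS.
Proof. by apply: (iffP sumsmx_subP) => H i /H; rewrite genmxE. Qed.

Lemma rspanS c d : c \subset d -> (rspan c <= rspan d)%MS.
Proof. by move=> /subsetP cd; apply/rspan_subP => i /cd /row_rspan. Qed.

Lemma rank_rspan c : (\rank (rspan c) <= #|c|)%N.
Proof.
rewrite (leq_trans (mxrank_sum_leqif _)) //= -sum1_card leq_sum // => i _.
by rewrite genmxE rank_leq_row.
Qed.

Lemma rank_rspanD c d : (\rank (rspan d) <= \rank (rspan c) + #|d :\: c|)%N.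
Proof.
apply: leq_trans (leq_add (leqnn _) (rank_rspan _)).
apply: leq_trans (mxrank_adds_leqif _ _).
apply/mxrankS/rspan_subP => i di; case: (boolP (i \in c)) => ci.
  by apply: submx_trans (addsmxSl _ _); apply: row_rspan.
by apply: submx_trans (addsmxSr _ _); apply: row_rspan; rewrite inE ci.
Qed.

Lemma indepS c d : c \subset d -> indep d -> indep c.
Proof.
move=> cd /eqP rd; rewrite /indep eqn_leq rank_rspan /=.
have := rank_rspanD c d; rewrite rd cardsD (setIidPr cd).
move: (subset_leq_card cd); move: #|d| #|c| (\rank _) => a b r; lia.
Qed.

Lemma indepU1 c i : indep c -> ~~ (row i V <= rspan c)%MS -> indep (i |: c).
Proof.
move=> /eqP rc ic; rewrite /indep eqn_leq rank_rspan /=.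
have ci : i \notin c by apply: contra ic => /row_rspan.
rewrite cardsU1 ci -rc add1n; apply/rank_ltmx.
rewrite ltmxE rspanS ?subsetUr //=.
by apply: contra ic => /rspan_subP; apply; rewrite setU11.
Qed.

(** A maximal independent set between [c] and [d] works, since a row of [d] outside its span could
    be adjoined. *)
Lemma indep_extend c d : c \subset d -> indep c ->
  exists b, [/\ c \subset b, b \subset d, indep b & (rspan d <= rspan b)%MS].
Proof.
move=> cd ic.
have [b /maxsetP[/andP[ib bd] maxb] cb] :=
  maxset_exists (P := fun b => indep b && (b \subset d))
    (introT andP (conj ic cd)).
exists b; split=> //; apply/rspan_subP => i di; apply: contraT => ib'.
have /setP/(_ i) : i |: b = b.
  by apply: maxb; rewrite /= ?subsetUr // indepU1 // subUset sub1set di.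
by rewrite setU11 => /esym/row_rspan; rewrite (negbTE ib').
Qed.

Lemma indep_card_eq d t : (t <= \rank (rspan d))%N ->
  exists c, [/\ c \subset d, indep c & #|c| = t].
Proof.
move=> td.
have i0 : indep set0 by rewrite /indep /rspan big_set0 mxrank0 cards0.
have [b [_ bd ib db]] := indep_extend (sub0set d) i0.
have tb : (t <= #|b|)%N by rewrite -(eqP ib) (leq_trans td) ?mxrankS.
have cb : [set x in take t (enum b)] \subset b.
  by apply/subsetP => x; rewrite inE => /mem_take; rewrite mem_enum.
exists [set x in take t (enum b)]; split; last first.
- by rewrite cardsE (card_uniqP _) ?take_uniq ?enum_uniq // size_takel -?cardE.
- exact: indepS ib.
- exact: subset_trans bd.
Qed.

Lemma basisE c : row_basis c = (#|c| == m) && indep c.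
Proof. by rewrite /row_basis /indep; case: eqP => //= ->. Qed.

(** Steinitz exchange with the elements of [h] protected. A minimal subset [d] of [b] whose span
    contains [row e] is not inside [h], and any [g] in [d] outside [h] may leave. *)
Lemma exchange b h e : row_basis b -> h \subset b -> e \notin b ->
  ~~ (row e V <= rspan h)%MS ->
  exists g, [/\ g \in b, g \notin h & row_basis (e |: b :\ g)].
Proof.
move=> /andP[/eqP cb fb] hb eb eh.
have [d /minsetP[/= ed mind] db] :=
  @minset_exists _ [pred d : {set _} | row e V <= rspan d]%MS b
    (submx_full _ fb).
have /subsetPn[g gd gh] : ~~ (d \subset h).
  by apply: contra eh => /rspanS; apply: submx_trans.
have gb := subsetP db g gd.
exists g; split=> //.
have edg : ~~ (row e V <= rspan (d :\ g))%MS.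
  apply/negP => /mind/(_ (subsetDl _ _))/setP/(_ g).
  by rewrite !inE eqxx gd.
have e_in : (row e V <= rspan (d :\ g) + row g V)%MS.
  apply: submx_trans ed _; apply/rspan_subP => i di.
  have [->|ig] := eqVneq i g; first exact: addsmxSr.
  by apply: submx_trans (addsmxSl _ _); apply: row_rspan; rewrite !inE ig.
rewrite /row_basis cardsU1 !inE (negbTE eb) andbF /= add1n.
have -> : #|b :\ g|.+1 = #|b| by rewrite (cardsD1 g b) gb.
rewrite cb eqxx /= -sub1mx; apply: submx_trans (submx_full _ fb) _.
set b' := e |: _.
have bb' : (rspan (b :\ g) <= rspan b')%MS by rewrite rspanS ?subsetUr.
have db' : (rspan (d :\ g) <= rspan b')%MS.
  by apply: submx_trans bb'; rewrite rspanS ?setSD.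
apply/rspan_subP => i bi.
have [->{i bi}|ig] := eqVneq i g; last first.
  by apply: submx_trans bb'; apply: row_rspan; rewrite !inE ig.
have [[u w] /= Ee] := sub_addsmxP e_in.
rewrite [w]mx11_scalar mul_scalar_mx in Ee.
(* [w] is the coefficient of [row g]; if it were zero, [d :\ g] would already span [row e]. *)
have w0 : w 0 0 != 0.
  apply: contra edg => /eqP w0; rewrite Ee w0 scale0r addr0; exact: submxMl.
have -> : row g V = (w 0 0)^-1 *: (row e V - u *m rspan (d :\ g)).
  by rewrite Ee addrC addKr scalerA mulVf ?scale1r.
apply: scalemx_sub; apply: addmx_sub; first by apply: row_rspan; rewrite setU11.
by rewrite eqmx_opp; apply: submx_trans db'; apply: submxMl.
Qed.

Lemma indep_row_notin c e : indep c -> e \in c ->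
  ~~ (row e V <= rspan (c :\ e))%MS.
Proof.
move=> ic ec; apply/negP => H.
have : (rspan c <= rspan (c :\ e))%MS.
  apply/rspan_subP => i ci; have [->//|ie] := eqVneq i e.
  by apply: row_rspan; rewrite !inE ie.
move/mxrankS; rewrite (eqP ic) => /leq_trans/(_ (rank_rspan _)).
by rewrite (cardsD1 e c) ec ltnn.
Qed.

Variable x0 : 'I_p.
(* [x0] is a junk value, never reached when [#|c| = k]. *)
Definition sel k c (j : 'I_k) : 'I_p := nth x0 (enum c) j.

Lemma sel_in k c j : #|c| = k -> @sel k c j \in c.
Proof. by move=> ck; rewrite -mem_enum mem_nth // -cardE ck. Qed.

Lemma selK k c i : #|c| = k -> i \in c -> exists j, @sel k c j = i.
Proof.
move=> ck ic.
have lt : (index i (enum c) < k)%N by rewrite -ck cardE index_mem mem_enum.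
by exists (Ordinal lt); rewrite /sel nth_index // mem_enum.
Qed.

Lemma sel_homo k c : #|c| = k -> {homo @sel k c : i j / (i < j)%N}.
Proof.
move=> ck i j ij.
have srt : sorted (relpre val ltn) (enum c).
  have -> : enum c = [seq x <- enum 'I_p | x \in c] by rewrite enumT.
  apply: sorted_filter; first by move=> x y z; apply: ltn_trans.
  by rewrite -sorted_map val_enum_ord iota_ltn_sorted.
by apply: (sorted_ltn_nth _ _ srt); rewrite ?inE -?cardE ?ck //;
  move=> x y z; apply: ltn_trans.
Qed.

Lemma rowsub_sel k c : #|c| = k -> (rowsub (@sel k c) V :=: rspan c)%MS.
Proof.
move=> ck; apply/eqmxP/andP; split.
  by apply/row_subP => j; rewrite row_rowsub; apply/row_rspan/sel_in.
apply/rspan_subP => i /(selK ck)[j <-].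
by apply: (eq_row_sub j); rewrite row_rowsub.
Qed.

Lemma det_sel_neq0 c : #|c| = m ->
  (\det (rowsub (@sel m c) V) != 0) = row_basis c.
Proof.
move=> cm; rewrite -unitfE -unitmxE -row_full_unit /row_basis cm eqxx /=.
by rewrite -!sub1mx rowsub_sel.
Qed.

End RowSpan.

(** * Rank and minors *)

Lemma rank_rowsub_homo (F : fieldType) (p q t : nat) (A : 'M[F]_(p, q)) :
  (t <= \rank A)%N ->
  exists2 f : 'I_t -> 'I_p, {homo f : i j / (i < j)%N}
    & \rank (rowsub f A) = t.
Proof.
(* [sel] needs a default index, so the matrix without rows is treated apart. *)
case: p A => [|p] A tA.
  have t0 : t = 0%N by apply/eqP; rewrite -leqn0 (leq_trans tA) ?rank_leq_row.
  by subst t; exists (fun i => i) => //; apply/eqP; rewrite -leqn0 rank_leq_row.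
have AT : (A <= rspan A setT)%MS.
  by apply/row_subP => i; apply: row_rspan; rewrite inE.
have [c [_ /eqP ic ct]] :=
  indep_card_eq (d := setT) (leq_trans tA (mxrankS AT)).
exists (sel ord0 c (k := t)); first exact: sel_homo.
by rewrite rowsub_sel // ic.
Qed.

(** If the rank is at least [t], choosing [t] independent rows and then [t] independent columns
    among them gives a nonzero minor. Conversely, a submatrix is a product with [X] in the middle,
    so its rank is at most that of [X]. *)
Lemma minors_eq0_rank (F : fieldType) (m n t : nat) (X : 'M[F]_(m, n)) :
  (forall a, is_minor t X a -> a = 0) <-> (\rank X < t)%N.
Proof.
split=> [H|Xt a [f [g [_ _ ->]]]].
  rewrite ltnNge; apply/negP => /rank_rowsub_homo[f f_homo rf].
  have := leqnn t; rewrite -{2}rf -mxrank_tr => /rank_rowsub_homo[g g_homo rg].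
  have /H/eqP : is_minor t X (\det (mxsub f g X)) by exists f, g.
  apply/negP; rewrite -unitfE -unitmxE -row_full_unit /row_full -mxrank_tr.
  suff -> : (mxsub f g X)^T = rowsub g (rowsub f X)^T by rewrite rg.
  by apply/matrixP => i j; rewrite !mxE.
apply/eqP/contraT; rewrite -unitfE -unitmxE => /mxrank_unit rt.
move: Xt; rewrite ltnNge -{1}rt.
rewrite (_ : mxsub f g X = rowsub f 1%:M *m X *m colsub g 1%:M).
  by rewrite (leq_trans (mxrankM_maxl _ _)) ?mxrankM_maxr.
rewrite mul_rowsub_mx mul1mx mulmx_colsub mulmx1.
by apply/matrixP=> i j; rewrite !mxE.
Qed.

(** * Weights of index sets *)

Section Weights.
Local Open Scope nat_scope.
Variables n m t : nat.
Hypotheses (tm : t <= m) (tn : t <= n).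
Implicit Types c : {set 'I_(n + m)}.

Definition low : {set 'I_(n + m)} := [set i : 'I_(n + m) | i < n].
Definition weight c := \sum_(i in c) (i : nat).
(** The admissible set of greatest weight: the last [t] rows of the block [X^T] and the last [m - t]
    rows of the block [1]. *)
Definition top : {set 'I_(n + m)} :=
  [set i : 'I_(n + m) | (n - t <= i < n) || (n + t <= i)].

Lemma sum_top (f : nat -> nat) :
  \sum_(i in top) f i = \sum_(n - t <= i < n) f i + \sum_(t <= j < m) f (n + j).
Proof.
rewrite big_split_ord /= !big_geq_mkord; congr (_ + _); apply: eq_bigl => i /=;
  by rewrite inE /=; have := ltn_ord i; lia.
Qed.

Lemma card_top : #|top| = m.
Proof. by rewrite -sum1_card (sum_top (fun=> 1)) !sum_nat_const_nat; lia. Qed.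

Lemma card_top_low : #|top :&: low| = t.
Proof.
rewrite -sum1_card big_split_ord /= [X in _ + X]big1 ?addn0; last first.
  by move=> i; rewrite !inE /=; lia.
rewrite (eq_bigl (fun i : 'I_n => true && (n - t <= i))).
  by rewrite -(big_geq_mkord _ _ xpredT (fun=> 1)) sum_nat_const_nat; lia.
by move=> i; rewrite !inE /=; have := ltn_ord i; lia.
Qed.

(** Compared with the indices below [m], the first [t] are shifted by [n - t] and the other [m - t]
    by [n]. *)
Lemma weight_top : weight top = \sum_(i < m) i + (m * n - t ^ 2).
Proof.
have E1 : \sum_(n - t <= i < n) i = \sum_(0 <= i < t) i + t * (n - t).
  rewrite -{1}(add0n (n - t)) (big_addn 0 n (n - t)) subKn // big_split /=.
  by rewrite sum_nat_const_nat subn0.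
rewrite /weight (sum_top id) /= E1 -(big_mkord xpredT (fun i : nat => i)).
rewrite [in RHS](big_cat_nat (n := t)) //= big_split /= sum_nat_const_nat.
rewrite mulnBr mulnBl -mulnn; have := leq_mul (leqnn t) tn.
have := leq_mul tm (leqnn n).
by move: (\sum_(0 <= i < t) i) (\sum_(t <= i < m) i) => u v; lia.
Qed.

(** Off their common part, [c] and the set of the first [m] indices have equally many elements, at
    least [m] in the former and below [m] in the latter. *)
Lemma weight_min c : #|c| = m -> \sum_(i < m) i <= weight c.
Proof.
move=> cm; have mnm : m <= n + m := leq_addl _ _.
rewrite (big_ord_widen _ id mnm).
pose bot : {set 'I_(n + m)} := [set i : 'I_(n + m) | i < m].
rewrite (eq_bigl (fun i => i \in bot)); last by move=> i; rewrite inE.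
have bm : #|bot| = m.
  rewrite -sum1_card (eq_bigl (fun i : 'I__ => i < m)) => [|i];
    last by rewrite inE.
  by rewrite -(big_ord_widen _ (fun=> 1) mnm) sum1_card card_ord.
rewrite /weight (big_setID c) (big_setID bot (A := c)) /= setIC leq_add2l.
have E : #|bot :\: c| = #|c :\: bot|.
  by rewrite !cardsD cm bm setIC.
apply: (@leq_trans (#|bot :\: c| * m)).
  by rewrite -sum_nat_const leq_sum // => i; rewrite !inE => /andP[_ /ltnW].
by rewrite E -sum_nat_const leq_sum // => i; rewrite !inE -leqNgt => /andP[].
Qed.

(** After the common part is cancelled, equally many indices remain on both sides, and [c] keeps at
    least as many low ones as [top]. The thresholds [n - t] and [n + t] separate the two sides in
    the low and the high range. *)
Lemma weight_lt_top c : #|c| = m -> t <= #|c :&: low| -> c != top ->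
  weight c < weight top.
Proof.
move=> cm ct neq.
pose a := #|(c :\: top) :&: low|; pose b := #|(c :\: top) :\: low|.
pose a' := #|(top :\: c) :&: low|; pose b' := #|(top :\: c) :\: low|.
have Eab : a + b = a' + b'.
  by rewrite !cardsID !cardsD cm card_top setIC.
have ab0 : 0 < a' + b'.
  rewrite cardsID lt0n cards_eq0 setD_eq0; apply: contra neq => tc.
  by rewrite eq_sym eqEcard tc cm card_top leqnn.
have aa' : a' <= a.
  rewrite -(leq_add2l #|c :&: top :&: low|).
  have -> : #|c :&: top :&: low| + a' = #|top :&: low|.
    by rewrite -(cardsID c (top :&: low)) /a' setIDAC -setIA setIC.
  rewrite card_top_low (leq_trans ct) // -(cardsID top (c :&: low)).
  by rewrite /a setIDAC setIAC.
(* The successor records strictness: each index of [c :\: top] lies strictly below its threshold. *)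
have up : \sum_(i in c :\: top) i.+1 <= a * (n - t) + b * (n + t).
  rewrite (big_setID low) /= -!sum_nat_const leq_add ?leq_sum // => i;
  by rewrite !inE; lia.
have down : a' * (n - t) + b' * (n + t) <= \sum_(i in top :\: c) i.
  rewrite [leqRHS](big_setID low) /= -!sum_nat_const leq_add ?leq_sum // => i;
  by rewrite !inE; lia.
have Ec : weight c = \sum_(i in c :&: top) i + \sum_(i in c :\: top) i.
  by rewrite /weight (big_setID top).
have Et : weight top = \sum_(i in c :&: top) i + \sum_(i in top :\: c) i.
  by rewrite /weight (big_setID c) setIC.
rewrite Ec Et ltn_add2l.
apply: leq_trans down; move: up.
under eq_bigr do rewrite -addn1.
rewrite big_split /= sum1_card -(cardsID low (c :\: top)) -/a -/b.
move: (\sum_(i in _) _) => s; nia.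
Qed.

End Weights.

Section Swap.
Variables n m : nat.
Local Notation low := (low n m).
Variables (b : {set 'I_(n + m)}) (e g : 'I_(n + m)).
Hypotheses (eb : e \notin b) (gb : g \in b) (eg : (e < g)%N).

Lemma weight_swap : (weight (e |: b :\ g) < weight b)%N.
Proof.
rewrite /weight big_setU1 ?(big_setD1 g gb) /= ?ltn_add2r //.
by rewrite !inE (negbTE eb) andbF.
Qed.

(** [low] is an initial segment, so exchanging [g] for a smaller [e] preserves admissibility. *)
Lemma card_low_swap : (#|b :&: low| <= #|(e |: b :\ g) :&: low|)%N.
Proof.
case: (ltnP e n) => en.
  rewrite (cardsD1 g (b :&: low)) (cardsD1 e (_ :&: low)) !inE eqxx en /=.
  apply: leq_add; first exact: leq_b1.
  apply/subset_leq_card/subsetP => i; rewrite !inE => /and3P[-> ib ->].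
  by rewrite ib orbT !andbT; apply: contraNneq eb => <-.
apply/subset_leq_card/subsetP => i; rewrite !inE => /andP[-> iN].
by rewrite iN !andbT; apply/orP; right; apply/eqP => E; subst i; lia.
Qed.
End Swap.

(** * Admissible minors and bases of least weight *)

Section Frame.
Variables (n m : nat) (x0 : 'I_(n + m)) (t : nat).

(** Up to sign, the maximal minors of this matrix are the minors of [X] of all sizes. *)
Definition frame (R : comNzRingType) (X : 'M[R]_(m, n)) : 'M[R]_(n + m, m) :=
  col_mx X^T 1%:M.

Definition frame_minor (R : comNzRingType) (X : 'M[R]_(m, n)) c : R :=
  \det (rowsub (sel x0 (k := m) c) (frame X)).

Definition admissible (c : {set 'I_(n + m)}) := (t <= #|c :&: low n m|)%N.

Definition minor_sum (R : comNzRingType) (X : 'M[R]_(m, n)) (k : nat) : R :=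
  \sum_(c : {set 'I_(n + m)} | [&& #|c| == m, admissible c & weight c == k])
    frame_minor X c.

Lemma map_frame_minor (R S : comNzRingType) (phi : {rmorphism R -> S}) X c :
  phi (frame_minor X c) = frame_minor (map_mx phi X) c.
Proof.
by rewrite /frame_minor -det_map_mx map_mxsub map_col_mx -map_trmx map_mx1.
Qed.

Lemma map_minor_sum (R S : comNzRingType) (phi : {rmorphism R -> S}) X k :
  phi (minor_sum X k) = minor_sum (map_mx phi X) k.
Proof.
by rewrite rmorph_sum; apply: eq_bigr => c _; apply: map_frame_minor.
Qed.

Section Field.
Variables (F : fieldType) (X : 'M[F]_(m, n)).
Local Notation V := (frame X).

Lemma row_frame_lshift j : row (lshift m j) V = row j X^T.
Proof. by rewrite rowKu. Qed.

Lemma rank_basis_low c : row_basis V c -> (#|c :&: low n m| <= \rank X)%N.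
Proof.
rewrite basisE => /andP[_ ic].
rewrite -(eqP (indepS (subsetIl c (low n m)) ic)) -(mxrank_tr X).
apply/mxrankS/rspan_subP => i; rewrite !inE => /andP[_ iN].
have -> : i = lshift m (Ordinal iN) by apply: val_inj.
by rewrite row_frame_lshift row_sub.
Qed.

(** Extend [t] independent columns of [X] to a basis by further rows of the frame, which span
    everything thanks to the block [1]. *)
Lemma exists_admissible_basis : (t <= \rank X)%N ->
  exists2 c, row_basis V c & admissible c.
Proof.
move=> tX.
have lowX : (X^T <= rspan V (low n m))%MS.
  apply/row_subP => j; rewrite -row_frame_lshift row_rspan // inE.
  exact: (ltn_ord j).
have tlow : (t <= \rank (rspan V (low n m)))%N.
  by rewrite (leq_trans tX) // -(mxrank_tr X) mxrankS.
have [c0 [c0low ic0 c0t]] := indep_card_eq tlow.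
have [c [c0c _ ic cT]] := indep_extend (subsetT c0) ic0.
exists c; last by rewrite /admissible -c0t subset_leq_card // subsetI c0c.
have fc : row_full (rspan V c).
  rewrite -sub1mx; apply: submx_trans cT; apply/row_subP => i.
  have -> : row i 1%:M = row (rshift n i) V by rewrite rowKd.
  by apply: row_rspan; rewrite inE.
by rewrite /row_basis fc -(eqP ic) andbT.
Qed.

Lemma minor_sum_eq0 k : (\rank X < t)%N -> minor_sum X k = 0.
Proof.
move=> Xt; apply: big1 => c /and3P[/eqP cm ct _]; apply/eqP.
rewrite -[_ == 0]negbK /frame_minor det_sel_neq0 //.
apply/negP => /rank_basis_low.
by move/(leq_trans ct); rewrite leqNgt Xt.
Qed.

Definition min_basis b := [/\ row_basis V b, admissible b &
  forall c, row_basis V c -> admissible c -> (weight b <= weight c)%N].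

Lemma exists_min_basis : (t <= \rank X)%N -> exists b, min_basis b.
Proof.
move=> /exists_admissible_basis[c cb cg].
pose P := [pred d | row_basis V d && admissible d].
have Pc : P c by rewrite /= cb.
case: (arg_minnP (@weight n m) Pc) => b /andP[bb bg] bm.
by exists b; split=> // d db dg; apply: bm; rewrite inE db.
Qed.

Lemma min_basis_not_swap b e g : min_basis b -> e \notin b -> g \in b ->
  (e < g)%N -> ~~ row_basis V (e |: b :\ g).
Proof.
move=> [_ bg bmin] eb gb eg; apply/negP => /bmin; rewrite leqNgt weight_swap //.
by move=> H; have := H (leq_trans bg (card_low_swap eb gb eg)).
Qed.

Lemma min_basis_uniq b d : min_basis b -> min_basis d -> b = d.
Proof.
move=> mb md; apply/eqP/contraT => neq.
pose P := [pred e | (e \in b) != (e \in d)].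
have [e0 e0P] : exists e, P e.
  apply/existsP; apply: contraNT neq; rewrite negb_exists => /forallP H.
  by apply/eqP/setP => i; apply/eqP; rewrite -[_ == _]negbK; apply: H.
(* Swap the least index on which the two bases differ into the other basis. *)
case: (arg_minnP (@nat_of_ord (n + m)) e0P) => e.
rewrite /P {P e0 e0P neq} /= => eP emin.
wlog eb : b d mb md eP emin / e \notin b.
  move=> W; case: (boolP (e \in b)) => eb; last exact: (W b d).
  apply: (W d b) => //; first by rewrite eq_sym.
    by move=> j; rewrite eq_sym => /emin.
  by move: eP; rewrite eb; case: (e \in d).
have ed : e \in d by move: eP; rewrite (negbTE eb); case: (e \in d).
have [/[dup] bb + _ _] := mb; rewrite basisE => /andP[_ _].
have [+ _ _] := md; rewrite basisE => /andP[_ id].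
(* Protecting [b :&: d] forces [g] out of [d], so [g] is another index of disagreement and exceeds
   [e]. Independence of [d] keeps [row e] out of the span of [b :&: d]. *)
have [|g [gb]] := exchange bb (subsetIl b d) eb.
  apply: contra (indep_row_notin id ed) => /submx_trans; apply; apply: rspanS.
  apply/subsetP => i; rewrite !inE => /andP[ib ->]; rewrite andbT.
  by apply: contraNneq eb => <-.
rewrite inE gb /= => gd bs.
suff /(min_basis_not_swap mb eb gb)/negP : (e < g)%N by [].
rewrite ltn_neqAle emin ?gb ?(negbTE gd) // andbT.
by apply: contraNneq eb => E; rewrite (val_inj E).
Qed.

(** Another nonzero term of the sum would come from a second admissible basis of least weight. *)
Lemma minor_sum_min_basis b : min_basis b ->
  minor_sum X (weight b) = frame_minor X b.
Proof.
move=> mb; have [/[dup] bb /andP[/eqP cb _] gb bmin] := mb.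
rewrite /minor_sum (bigD1 b) /= ?cb ?gb ?eqxx //=.
rewrite big1 ?addr0 // => d /andP[/and3P[/eqP cd gd /eqP wd] db].
apply/eqP; rewrite -[_ == 0]negbK /frame_minor det_sel_neq0 //.
apply: contra db => bd; apply/eqP/min_basis_uniq => //.
by split=> // c; rewrite wd; apply: bmin.
Qed.

(** The sum at the weight of the minimal basis is nonzero, so this weight is the greatest one and
    the basis is [top]. A nonzero first column could then be exchanged for some element of [top],
    which would lower the weight. *)
Lemma minor_sums_eq0_top (j0 : 'I_n) : (t <= m)%N -> (t < n)%N ->
  j0 = 0%N :> nat -> (t <= \rank X)%N ->
  (forall k, (k < m * n - t ^ 2)%N -> minor_sum X (\sum_(i < m) i + k) = 0) ->
  frame_minor X (top n m t) != 0 /\ col j0 X = 0.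
Proof.
move=> tm tn j00 /exists_min_basis[b mb] H.
have [/[dup] bb /andP[/eqP cb _] gb bmin] := mb.
have bt : b = top n m t.
  apply/eqP/contraT => /(weight_lt_top tm (ltnW tn) cb gb).
  rewrite weight_top ?(ltnW tn) // => wb.
  have := minor_sum_min_basis mb.
  have := weight_min cb => wm; rewrite -(subnKC wm) H; last by lia.
  by move/esym/eqP/negPn; rewrite /frame_minor det_sel_neq0 // bb.
split; first by rewrite -bt /frame_minor det_sel_neq0.
apply: (can_inj trmxK); rewrite tr_col trmx0 -row_frame_lshift.
apply/eqP/contraT => r0.
(* Here [t < n] matters: it makes every index in [top] positive. *)
have jb : lshift m j0 \notin b by rewrite bt inE /= j00; lia.
have [|g [gb' _ bs]] := exchange bb (sub0set b) jb.
  by rewrite /rspan big_set0 submx0.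
suff /(min_basis_not_swap mb jb gb')/negP : (lshift m j0 < g)%N by [].
by rewrite /= j00; move: gb'; rewrite bt inE; lia.
Qed.

End Field.
End Frame.

(** * The shear *)

Section Shear.
Variables (R : comNzRingType) (n m : nat) (x0 : 'I_(n + m)) (t : nat).
Variables (i0 : 'I_m) (j0 : 'I_n).
Hypotheses (j00 : j0 = 0%N :> nat) (tm : (t <= m)%N) (tn : (t < n)%N).
Variable X : 'M[R]_(m, n).
Local Notation tp := (sel x0 (k := m) (top n m t)).
Local Notation M := (rowsub tp (frame X)).

(** Row [i0] of the adjugate of [M], placed at the columns of [X] that [top] selects and zero
    elsewhere. Pairing it with row [i0] of [X] will give [\det M]. *)
Definition shear_col : 'cV[R]_n :=
  \col_l \sum_j ((tp j == lshift m l)%:R * (\adj M) i0 j).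

Definition shear : 'M[R]_(m, n) := X + X *m (shear_col *m delta_mx 0 j0).

Lemma sel_top j : tp j \in top n m t.
Proof. by apply: sel_in; rewrite card_top // ltnW. Qed.

Lemma shear_col0 : shear_col j0 0 = 0.
Proof.
rewrite mxE big1 // => j _; case: eqP => [E|]; last by rewrite mul0r.
by have := sel_top j; rewrite E inE /= j00; lia.
Qed.

Lemma shearE i j : shear i j = X i j + (X *m shear_col) i 0 * (j == j0)%:R.
Proof.
by rewrite /shear mulmxA !mxE big_ord1 !mxE.
Qed.

(** The shear alters only column [j0], which [top] does not select. *)
Lemma frame_minor_top_shear :
  frame_minor x0 shear (top n m t) = frame_minor x0 X (top n m t).
Proof.
congr (\det _); apply/matrixP => j i; rewrite !mxE.
have := sel_top j; case: (split_ordP (tp j)) => l ->; rewrite inE /=;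
  rewrite ?col_mxEu ?col_mxEd // ![_^T _ _]mxE shearE => lt.
by case: eqP => [E|]; [move: lt; rewrite E j00; lia | rewrite mulr0 addr0].
Qed.

Lemma shear_mul : shear = X *m (1%:M + shear_col *m delta_mx 0 j0).
Proof. by rewrite mulmxDr mulmx1. Qed.

(** Entry [j0] of [shear_col] is zero, so the added matrix squares to zero. *)
Lemma shear_inv : X = shear *m (1%:M - shear_col *m delta_mx 0 j0).
Proof.
have N0 : (shear_col *m delta_mx 0 j0) *m (shear_col *m delta_mx 0 j0) = 0
    :> 'M_n.
  rewrite -mulmxA (mulmxA (delta_mx 0 j0)) -rowE.
  by rewrite [row j0 _]mx11_scalar mxE shear_col0 mul_scalar_mx scale0r mulmx0.
rewrite shear_mul -mulmxA mulmxBr mulmx1 mulmxDl mul1mx N0 addr0 addrK.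
by rewrite mulmx1.
Qed.

Lemma rank_map_shear (F : fieldType) (phi : {rmorphism R -> F}) :
  \rank (map_mx phi shear) = \rank (map_mx phi X).
Proof.
apply/eqP; rewrite eqn_leq; apply/andP; split.
  by rewrite shear_mul map_mxM mxrankM_maxl.
by rewrite [in leqLHS]shear_inv map_mxM mxrankM_maxl.
Qed.

Hypotheses (i00 : i0 = 0%N :> nat) (t1 : (1 <= t)%N).

(* [\adj M *m M = \det M] at the corner: the rows of [M] taken from [1] have
   index at least [t], so they contribute 0 to the column [i0 = 0]. *)
Lemma shear_colE : (X *m shear_col) i0 0 = \det M.
Proof.
have -> : \det M = (\adj M *m M) i0 i0 by rewrite mul_adj_mx !mxE eqxx.
rewrite !mxE; under eq_bigr do rewrite mxE big_distrr /=.
rewrite exchange_big /=; apply: eq_bigr => j _.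
under eq_bigr do rewrite mulrCA.
rewrite [LHS](_ : _ = (\adj M) i0 j * \sum_l (tp j == lshift m l)%:R * X i0 l).
  congr (_ * _); rewrite [in RHS]mxE.
  have := sel_top j; case: (split_ordP (tp j)) => l ->; rewrite inE /=.
    rewrite col_mxEu mxE (bigD1 l) //= eqxx mul1r big1 ?addr0 // => k kl.
    by rewrite (inj_eq (@lshift_inj _ _)) eq_sym (negbTE kl) mul0r.
  move=> lt; rewrite col_mxEd mxE big1 => [|k _]; last first.
    by rewrite eq_rlshift mul0r.
  by case: eqP => // E; move: lt; have := ltn_ord l; rewrite E i00; lia.
by rewrite big_distrr; apply: eq_bigr => l _; rewrite /= [RHS]mulrC mulrA.
Qed.

Lemma shear_corner : shear i0 j0 = X i0 j0 + frame_minor x0 X (top n m t).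
Proof. by rewrite shearE shear_colE eqxx mulr1. Qed.

End Shear.

(** * From equations at field points to the arithmetical rank *)

Lemma map_minors (R : comNzRingType) (F : fieldType) (m n t : nat)
    (X : 'M[R]_(m, n)) (phi : {rmorphism R -> F}) :
  (forall a, is_minor t X a -> phi a = 0) <-> (\rank (map_mx phi X) < t)%N.
Proof.
rewrite -minors_eq0_rank; split=> H a [f [g [fh gh ->]]].
  by rewrite -map_mxsub det_map_mx; apply: H; exists f, g.
by rewrite -det_map_mx map_mxsub; apply: H; exists f, g.
Qed.

(** Otherwise some field point kills [T] but not [a]; it also kills [S], hence a power of [a]. *)
Lemma radical_le (R : comNzRingType) (S T : R -> Prop) :
  (forall (F : fieldType) (phi : {rmorphism R -> F}),
     (forall a, T a -> phi a = 0) -> forall a, S a -> phi a = 0) ->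
  forall a, ideal_radical (ideal_gen S) a -> ideal_radical (ideal_gen T) a.
Proof.
move=> H a [k [l [c [s [Ss Ea]]]]]; apply: boolp.contrapT.
move=> /radical_field_point[F [phi [/H phiS /negP]]]; apply.
suff : phi (a ^+ k) = 0.
  by rewrite rmorphXn => /eqP; rewrite expf_eq0 => /andP[].
rewrite Ea rmorph_sum big1 // => i _.
by rewrite rmorphM /= (phiS _ (Ss i)) mulr0.
Qed.

Lemma generated_up_to_radical_minors (R : comNzRingType) (m n t : nat)
    (X : 'M[R]_(m, n)) (r : nat) (f : 'I_r -> R) :
  (forall (F : fieldType) (phi : {rmorphism R -> F}),
     (\rank (map_mx phi X) < t)%N <-> forall i, phi (f i) = 0) ->
  generated_up_to_radical (minors_ideal t X) r.
Proof.
move=> H; exists f => a; split; apply: radical_le => F phi.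
  move=> f0; apply/map_minors/H => i; apply: f0; by exists i.
by move=> /map_minors/H f0 _ [i ->].
Qed.

Lemma corner_zero_equations (R : comNzRingType) (m n t : nat)
    (X : 'M[R]_(m, n)) (i0 : 'I_m) (j0 : 'I_n) :
  (1 <= t)%N -> (t <= m)%N -> (t < n)%N ->
  i0 = 0%N :> nat -> j0 = 0%N :> nat -> X i0 j0 = 0 ->
  exists f : 'I_(m * n - t ^ 2) -> R,
    forall (F : fieldType) (phi : {rmorphism R -> F}),
     (\rank (map_mx phi X) < t)%N <-> forall i, phi (f i) = 0.
Proof.
move=> t1 tm tn i00 j00 X0; pose x0 := lshift m j0.
(* The offset is the least possible weight, and the range of [k] stops just before the weight of
   [top]. *)
exists (fun k => minor_sum x0 t (shear x0 t i0 j0 X) (\sum_(i < m) i + k)).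
move=> F phi; rewrite -(rank_map_shear x0 i0 j00 tm tn); split=> [lt k|H].
  by rewrite map_minor_sum minor_sum_eq0.
rewrite ltnNge; apply/negP.
move=> /(minor_sums_eq0_top (x0 := x0) tm tn j00)[|/negP z0 /colP/(_ i0)].
  by move=> k lt; rewrite -map_minor_sum; apply: (H (Ordinal lt)).
rewrite mxE [LHS]mxE [RHS]mxE shear_corner // X0 add0r => z.
by apply: z0; rewrite -map_frame_minor frame_minor_top_shear // z.
Qed.

Lemma exists_is_ara (R : comNzRingType) (I : R -> Prop) (s : nat) :
  generated_up_to_radical I s -> exists r, is_ara I r /\ (r <= s)%N.
Proof.
elim/ltn_ind: s => s IH gs.
have [[r [rs gr]]|H] :=
    boolp.pselect (exists r, (r < s)%N /\ generated_up_to_radical I r).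
  have [q [aq qr]] := IH r rs gr.
  by exists q; split=> //; apply: leq_trans qr (ltnW rs).
exists s; split=> //; split=> // r gr; rewrite leqNgt; apply/negP => rs.
by apply: H; exists r.
Qed.

Theorem corollary3p2 (K : closedFieldType) (N m n t : nat)
    (X : 'M[{mpoly K[N]}]_(m, n)) :
  (0 < m)%N -> (m <= n)%N ->
  (1 <= t)%N -> (t <= m)%N -> (t < n)%N ->
  (exists (i : 'I_m) (j : 'I_n), X i j = 0) ->
  exists r : nat, is_ara (minors_ideal t X) r /\ (r <= m * n - t ^ 2)%N.
Proof.
move=> m0 mn t1 tm tn [i [j Xij]]; apply: exists_is_ara.
pose i0 := Ordinal m0; pose j0 := Ordinal (leq_trans m0 mn).
(* Moving the zero entry to the corner preserves the rank at every point, so the equations found for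
   [Y] also serve [X]. *)
pose Y := xrow i i0 (xcol j j0 X).
have Y0 : Y i0 j0 = 0 by rewrite !mxE !tpermR.
have [f Hf] :=
  corner_zero_equations (i0 := i0) (j0 := j0) t1 tm tn erefl erefl Y0.
apply: (generated_up_to_radical_minors (f := f)) => F phi.
rewrite -Hf /Y map_xrow map_xcol xrowE xcolE.
rewrite eqmxMfull; last by rewrite row_full_unit unitmx_perm.
by rewrite mxrankMfree // row_free_unit unitmx_perm.
Qed.
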